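(* Let $A$ and $B$ be closed convex sets in $\mathbb{E}$ with nonempty intersection and let $(x_k)_{k\in\mathbb{N}}$ be an alternating projections sequence for $A$ and $B$. Then $(x_k)_{k\in\mathbb{N}}$ converges R-linearly (with some rate in $[0,1)$) to a point in $A\cap B$ if and only if $(x_k)_{k\in\mathbb{N}}$ is linearly monotone with respect to $A\cap B$ with some constant in $[0,1)$.
   Context: $\mathbb{E}$ is a Euclidean space; $\operatorname{dist}(x,C):=\inf_{a\in C}\|x-a\|$; $P_C$ is the projection onto the nonempty closed convex set $C$. Alternating projections sequence: $x_{k+1}=P_AP_Bx_k$ for all $k\in\mathbb{N}$, with $x_0\in A$. R-linear convergence to $\tilde x$ with rate $c\in[0,1)$: there is $\gamma>0$ with $\|x_k-\tilde x\|\le\gamma c^k$ for all $k\in\mathbb{N}$. Linear monotonicity with respect to $S$ with constant $c$: $\operatorname{dist}(x_{k+1},S)\le c\operatorname{dist}(x_k,S)$ for all $k\in\mathbb{N}$. *)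

(* Defs.v *)
From HB Require Import structures.
From mathcomp Require Import all_boot all_order all_algebra.
From mathcomp Require Import all_classical all_reals all_analysis.

Set Implicit Arguments.
Unset Strict Implicit.
Unset Printing Implicit Defensive.

Import Order.TTheory GRing.Theory Num.Theory.
Import numFieldNormedType.Exports.

Local Open Scope classical_set_scope.
Local Open Scope ring_scope.

Definition finite_dimensional (R : realType) (E : normedModType R) : Prop :=
  exists (n : nat) (b : 'I_n -> E),
    forall x : E, exists a : 'I_n -> R, x = \sum_(i < n) a i *: b i.

(* A Euclidean space is a finite-dimensional normed space whose norm is the one
   induced by the (symmetric bilinear positive definite) form [dot]; the
   topology of [E] as a [normedModType] is then the Euclidean topology. The
   library's ['rV[R]_n] is not used because it carries the sup norm. *)
Definition euclidean (R : realType) (E : normedModType R)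
    (dot : {dot E for (@idfun R)}) : Prop :=
  finite_dimensional E /\ (forall x : E, `|x| ^+ 2 = dot x x).

Section alternating_projections.
Variables (R : realType) (E : normedModType R).
Implicit Types (A B C S : set E) (x p : E) (u : nat -> E) (c : R).

(* [inf] is total on [set R]; this is the mathematical infimum for nonempty [C],
   the set of distances being bounded below by 0. *)
Definition dist x C : R := inf [set `|x - a| | a in C].

(* The point of [C] at distance [dist x C] from [x], which exists and is unique
   when [C] is nonempty, closed and convex in a Euclidean space; [0] is a dummy
   value returned when there is no such point. *)
Definition proj C x : E := xget 0 [set p | C p /\ `|x - p| = dist x C].

Definition alternating_projections A B u : Prop :=
  A (u 0%N) /\ (forall k : nat, u k.+1 = proj A (proj B (u k))).

Definition R_linear_cvg u x c : Prop :=
  exists2 gamma : R, 0 < gamma & forall k : nat, `|u k - x| <= gamma * c ^+ k.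

Definition linearly_monotone u S c : Prop :=
  forall k : nat, dist (u k.+1) S <= c * dist (u k) S.

End alternating_projections.

(* Main.v *)
Require Import Defs.
From HB Require Import structures.
From mathcomp Require Import all_boot all_order all_algebra.
From mathcomp Require Import all_classical all_reals all_analysis.
From mathcomp Require Import ring lra.

Set Implicit Arguments.
Unset Strict Implicit.
Unset Printing Implicit Defensive.

Import Order.TTheory GRing.Theory Num.Theory.
Import numFieldNormedType.Exports.

Local Open Scope classical_set_scope.
Local Open Scope ring_scope.

(** Write [S] for the intersection of [A] and [B], [b k] for the projection of
    [x k] onto [B], and [d k] for the gap [`|x k - b k|], which is the distance
    from [x k] to [B].

    Linear monotonicity gives R-linear convergence because the sequence is
    Fejer monotone: its distance to each point of [S] never increases
    ([alternating_fejer]). Hence any two later terms lie within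
    [2 * dist (x k) S] of each other, and a cluster point of the bounded
    sequence is a limit in [S] reached at the rate at which the distances to
    [S] decrease.

    The converse needs more than the limiting behaviour of the distances, since
    linear monotonicity is a uniform estimate at every step. The reason it
    holds is that the gaps are log-convex ([gap_log_convex]): the obtuse angle
    property of projections, applied to three consecutive segments of the
    zigzag [x k, b k, x k.+1, b k.+1], says that the middle length is at most
    the geometric mean of its neighbours ([zigzag]). The ratios
    [d k.+1 / d k] are then nondecreasing. As [d k] is bounded by the distance
    from [x k] to the limit, R-linear convergence with rate [c] bounds every
    one of these ratios by [c] ([log_convex_ratio_le]). Summing the steps from
    [x k] on, each at most twice the corresponding gap, bounds the distance
    from [x k] to the limit, hence to [S], by [2 / (1 - c) * d k]. Finally the
    squared distance to [S] drops by at least [d k ^+ 2] at step [k]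
    ([alternating_dist_fejer]), and this is a fixed fraction of it.

    Projections exist because closed bounded sets are compact in a
    finite-dimensional inner product space, where an orthonormal family gives
    coordinates bounded by the norm ([closed_bounded_compact]). *)

(** * Inner product spaces of finite dimension *)

Section inner_product.
Variables (R : realType) (E : normedModType R) (dot : {dot E for (@idfun R)}).
Implicit Types (u v w x p q r : E) (a : R) (s : seq E).

Lemma dotC u v : dot u v = dot v u.
Proof. by rewrite hermC expr0 mul1r. Qed.

Lemma dotDl u v w : dot (u + v) w = dot u w + dot v w.
Proof. exact: linearDl. Qed.

Lemma dotDr u v w : dot u (v + w) = dot u v + dot u w.
Proof. by rewrite dotC dotDl ![dot u _]dotC. Qed.

Lemma dotBl u v w : dot (u - v) w = dot u w - dot v w.
Proof. exact: linearBl. Qed.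

Lemma dotBr u v w : dot u (v - w) = dot u v - dot u w.
Proof. by rewrite dotC dotBl ![dot u _]dotC. Qed.

Lemma dotZl a u v : dot (a *: u) v = a * dot u v.
Proof. exact: linearZl_LR. Qed.

Lemma dotZr a u v : dot u (a *: v) = a * dot u v.
Proof. by rewrite dotC dotZl [dot u _]dotC. Qed.

Lemma dot0l u : dot 0 u = 0.
Proof. exact: linear0l. Qed.

Lemma dot_suml (I : Type) (s : seq I) (f : I -> E) u :
  dot (\sum_(i <- s) f i) u = \sum_(i <- s) dot (f i) u.
Proof.
by elim: s => [|i s IH]; rewrite ?big_nil ?dot0l // !big_cons dotDl IH.
Qed.

(** The orthogonal projection onto the span of [s] when [s] is orthonormal. *)
Definition dot_expansion s x := \sum_(v <- s) dot x v *: v.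

Lemma dot_expansionD s x y :
  dot_expansion s (x + y) = dot_expansion s x + dot_expansion s y.
Proof.
by rewrite -big_split; apply: eq_bigr => v _; rewrite dotDl scalerDl.
Qed.

Lemma dot_expansionZ s a x : dot_expansion s (a *: x) = a *: dot_expansion s x.
Proof.
by rewrite scaler_sumr; apply: eq_bigr => v _; rewrite dotZl scalerA.
Qed.

Lemma dot_expansionB s x y :
  dot_expansion s (x - y) = dot_expansion s x - dot_expansion s y.
Proof. by rewrite dot_expansionD -scaleN1r dot_expansionZ scaleN1r. Qed.

Lemma dot_expansion_sum s (I : Type) (t : seq I) (f : I -> E) :
  dot_expansion s (\sum_(i <- t) f i) = \sum_(i <- t) dot_expansion s (f i).
Proof.
elim: t => [|i t IH]; last by rewrite !big_cons dot_expansionD IH.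
by rewrite !big_nil; apply: big1 => v _; rewrite dot0l scale0r.
Qed.

Lemma dot_expansion_sym s x y :
  dot (dot_expansion s x) y = dot x (dot_expansion s y).
Proof.
rewrite dot_suml [RHS]dotC dot_suml; apply: eq_bigr => v _.
by rewrite !dotZl mulrC [dot v y]dotC [dot v x]dotC.
Qed.

(** Induction on [bs], adding to [s] the normalized residue [w] of a new vector.
    That the expansion along [s] fixes [s] stands in for orthonormality: it
    makes the expansion idempotent, and since it is also self-adjoint, [w] is
    orthogonal to everything fixed so far. *)
Lemma gram_schmidt (bs : seq E) : exists s,
  {in s, forall v, dot_expansion s v = v} /\
  {in bs, forall b, dot_expansion s b = b}.
Proof.
elim: bs => [|b bs [s [sK bsK]]]; first by exists [::].
pose w := b - dot_expansion s b.
have TT y : dot_expansion s (dot_expansion s y) = dot_expansion s y.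
  rewrite [in LHS]/dot_expansion -/(dot_expansion s _) dot_expansion_sum.
  rewrite /dot_expansion big_seq [RHS]big_seq; apply: eq_bigr => v vs.
  by rewrite -/(dot_expansion _ _) dot_expansionZ sK.
have Tw : dot_expansion s w = 0 by rewrite dot_expansionB TT subrr.
(* [w] is killed by the self-adjoint expansion, so orthogonal to its range. *)
have orth y : dot_expansion s y = y -> dot y w = 0.
  by move=> <-; rewrite dot_expansion_sym Tw dotC dot0l.
have [w0|w0] := eqVneq w 0.
  exists s; split => // v; rewrite inE => /predU1P[->|/bsK//].
  by apply/esym/eqP; rewrite -subr_eq0 -/w w0.
have ww : dot w w != 0 by rewrite gt_eqF// neq0_dnorm_gt0.
pose n := Num.sqrt (dot w w).
have nn : n^-1 * n^-1 = (dot w w)^-1.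
  by rewrite -invfM -expr2 sqr_sqrtr// ltW// neq0_dnorm_gt0.
have expE y : dot_expansion (n^-1 *: w :: s) y =
    ((dot w w)^-1 * dot y w) *: w + dot_expansion s y.
  by rewrite /dot_expansion big_cons dotZr scalerA mulrAC nn.
have keep y : dot_expansion s y = y ->
    dot_expansion (n^-1 *: w :: s) y = y.
  by move=> sy; rewrite expE sy (orth y sy) mulr0 scale0r add0r.
exists (n^-1 *: w :: s); split => v; rewrite inE => /predU1P[->|].
- by rewrite dot_expansionZ expE Tw mulVf// scale1r addr0.
- by move/sK/keep.
- have -> : b = w + dot_expansion s b by rewrite /w subrK.
  rewrite dot_expansionD [X in _ + X]keep// expE Tw.
  by rewrite mulVf// scale1r addr0.
- by move/bsK/keep.
Qed.

Hypothesis eucl : euclidean dot.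

Lemma finite_frame : exists s, forall x, x = dot_expansion s x.
Proof.
have [[n [b bP]] _] := eucl.
have [s [_ sb]] := gram_schmidt [seq b i | i <- enum 'I_n].
exists s => x; have [a ->] := bP x.
rewrite dot_expansion_sum; apply: eq_bigr => i _.
by rewrite dot_expansionZ sb// map_f// mem_enum.
Qed.

Lemma normr_sqr x : `|x| ^+ 2 = dot x x.
Proof. by case: eucl. Qed.

Lemma sqr_normB x y :
  `|x - y| ^+ 2 = `|x| ^+ 2 - 2 * dot x y + `|y| ^+ 2.
Proof.
by rewrite !normr_sqr !dotBl !dotBr (dotC y x); ring.
Qed.

Lemma cauchy_schwarz x y : dot x y <= `|x| * `|y|.
Proof.
have [->|x0] := eqVneq x 0; first by rewrite dot0l normr0 mul0r.
have [->|y0] := eqVneq y 0; first by rewrite dotC dot0l normr0 mulr0.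
have nx : 0 < `|x| by rewrite normr_gt0.
have ny : 0 < `|y| by rewrite normr_gt0.
(* For nonzero vectors, expand the squared norm of a combination that vanishes
   when [x] and [y] are positively proportional. *)
have := sqr_ge0 `|(`|y| *: x - `|x| *: y)|.
rewrite sqr_normB dotZl dotZr !normrZ !normr_id => h.
have : 0 < `|x| * `|y| by rewrite mulr_gt0.
set P := dot x y in h *; move: h nx ny; set X := `|x|; set Y := `|y|.
move=> h nx ny XY; rewrite leNgt; apply/negP => PXY.
have : X * Y * (P - X * Y) > 0 by rewrite mulr_gt0// subr_gt0.
by move: h; nra.
Qed.

(** Cauchy-Schwarz bounds the coordinates along a finite frame, so a bounded set
    lies in the image of a box under a linear, hence continuous, map. *)
Lemma closed_bounded_compact (C : set E) M :
  closed C -> (forall c, C c -> `|c| <= M) -> compact C.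
Proof.
move=> clC CM; have [s sE] := finite_frame.
pose f (r : 'rV[R]_(size s)) : E := \sum_(i < size s) r ord0 i *: s`_i.
pose N (i : 'I_(size s)) := M * `|s`_i|.
have cf : continuous f.
  apply: continuous_big => [|i _ r]; first exact: add_continuous.
  apply: cvgZr_tmp; first exact: (@nbhs_filter _ r).
  exact: (@coord_continuous R 1 (size s) ord0 i).
have K := @rV_compact _ _ (fun i => `[- N i, N i]%classic : set R)
  (fun i => @segment_compact _ _ _).
apply: (subclosed_compact clC (continuous_compact _ K)).
  exact: continuous_subspaceT cf.
move=> c Cc; exists (\row_i dot c s`_i).
  move=> i; rewrite mxE /= in_itv/=.
  have : dot c s`_i <= `|c| * `|s`_i| by exact: cauchy_schwarz.
  have : dot (- c) s`_i <= `|c| * `|s`_i|.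
    by rewrite -[`|c|]normrN; exact: cauchy_schwarz.
  rewrite -[- c]scaleN1r dotZl.
  have : `|c| * `|s`_i| <= N i by rewrite ler_wpM2r ?CM.
  lra.
rewrite /f [RHS]sE /dot_expansion (big_nth 0) big_mkord.
by apply: eq_bigr => i _; rewrite mxE.
Qed.

End inner_product.

(** * Distances and projections *)

Section distance.
Variables (R : realType) (E : normedModType R).
Implicit Types (x c : E) (C : set E) (m e : R).

Lemma dist_le x C c : C c -> dist x C <= `|x - c|.
Proof.
by move=> Cc; apply: ge_inf; [exists 0 => _ [a _ <-] | exists c].
Qed.

Lemma le_dist x C m :
  C !=set0 -> (forall c, C c -> m <= `|x - c|) -> m <= dist x C.
Proof.
move=> [c Cc] mC; apply: lb_le_inf; first by exists `|x - c|, c.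
by move=> _ [a Ca <-]; exact: mC.
Qed.

Lemma dist_ge0 x C : C !=set0 -> 0 <= dist x C.
Proof. by move=> C0; apply: le_dist. Qed.

Lemma dist_adherent x C e :
  C !=set0 -> 0 < e -> exists2 c, C c & `|x - c| < dist x C + e.
Proof.
move=> [c Cc] e0; have [|_ [a Ca <-] ?] := @inf_adherent R
  [set `|x - a| | a in C] e e0; last by exists a.
by split; [exists `|x - c|, c | exists 0 => _ [a _ <-]].
Qed.

End distance.

Section projection.
Variables (R : realType) (E : normedModType R) (dot : {dot E for (@idfun R)}).
Hypothesis eucl : euclidean dot.
Implicit Types (x p q r s : E) (C : set E) (u : nat -> E).

Lemma bounded_cluster C u M :
  closed C -> (forall n, C (u n)) -> (forall n, `|u n| <= M) ->
  exists2 p, C p & forall e N, 0 < e ->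
    exists2 n, (N <= n)%N & `|u n - p| < e.
Proof.
move=> clC Cu uM.
pose D := C `&` [set c | `|c| <= M].
have cD : compact D.
  apply: (closed_bounded_compact eucl (M := M)) => [|c []//].
  apply: closedI => //.
  apply: (@closed_comp _ _ (fun c : E => `|c|) [set r | r <= M]) => [c _|].
    exact: norm_continuous.
  exact: closed_le.
have [|p [[Cp _] pu]] := cD (u @ \oo) _.
  by exists 0%N => // n _; split; [exact: Cu|exact: uM].
exists p => // e N e0.
have [||_ [[n /= Nn <-]]] := pu (u @` [set n | (N <= n)%N]) (ball p e).
- by exists N => // n /= Nn; exists n.
- exact: nbhsx_ballx.
- rewrite -ball_normE /= distrC => une.
  by exists n.
Qed.

(** A cluster point of a minimizing sequence realizes the distance. *)
Lemma projP x C : closed C -> C !=set0 ->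
  C (Defs.proj C x) /\ `|x - Defs.proj C x| = dist x C.
Proof.
move=> clC C0.
suff [p Pp] : exists p, C p /\ `|x - p| = dist x C.
  exact: (@xgetPex E 0 [set q | C q /\ `|x - q| = dist x C] (ex_intro _ p Pp)).
have pos (n : nat) : 0 < n.+1%:R^-1 :> R by rewrite invr_gt0.
have /choice[u Pu] : forall n : nat, exists c,
    C c /\ `|x - c| < dist x C + n.+1%:R^-1.
  by move=> n; have [c] := dist_adherent x C0 (pos n); exists c.
have [n||p Cp up] := @bounded_cluster C u (`|x| + dist x C + 1) clC.
- by case: (Pu n).
- move=> n; have [_ h] := Pu n.
  have -> : u n = x - (x - u n) by rewrite subKr.
  apply: le_trans (ler_normB _ _) _.
  rewrite -addrA lerD2l (le_trans (ltW h))// lerD2l.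
  by rewrite invf_le1// ler1n.
exists p; split => //; apply/eqP; rewrite eq_le dist_le// andbT.
apply/ler_addgt0Pr => e e0.
have e20 : 0 < e / 2 by rewrite divr_gt0.
have [N] := ltr_add_invr e20; rewrite add0r => Ne.
have [n Nn unp] := up _ N e20.
have [_ h] := Pu n.
have : n.+1%:R^-1 <= N.+1%:R^-1 :> R by rewrite lef_pV2 ?posrE// ler_nat ltnS.
have : `|x - p| <= `|x - u n| + `|u n - p|.
  by apply: le_trans (ler_normD _ _); rewrite subrKA.
move: h Ne; set a := n.+1%:R^-1; set b := N.+1%:R^-1.
lra.
Qed.

(** If the angle at the projection [p] were acute, moving from [p] towards [c]
    by a small enough fraction [t] would bring the point closer to [x]. *)
Lemma proj_obtuse x C c : closed C -> convex_set C -> C c ->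
  dot (x - Defs.proj C x) (c - Defs.proj C x) <= 0.
Proof.
move=> clC cvC Cc; have [|] := @projP x C clC; first by exists c.
set p := Defs.proj C x => Cp pE; rewrite leNgt; apply/negP => v0.
set v := dot _ _ in v0.
have w0 : 0 <= `|c - p| ^+ 2 by exact: sqr_ge0.
set w := `|c - p| ^+ 2 in w0.
(* Moving by [t] decreases the squared distance by [2 * t * v - t ^+ 2 * w], so
   any positive [t <= 1] below [2 * v / w] would do; this one needs no separate
   treatment of [w = 0]. *)
pose t := v / (w + v).
have wv : 0 < w + v by rewrite ltr_wpDl.
have t0 : 0 < t by rewrite divr_gt0.
have t1 : t <= 1 by rewrite ler_pdivrMr// mul1r lerDr.
have tE : t * (w + v) = v by rewrite /t divfK// gt_eqF.
have Ct : C (p + t *: (c - p)).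
  have := cvC c p (Itv01 (ltW t0) t1); rewrite !inE => /(_ Cc Cp).
  congr (C _); rewrite /conv /= /unstable.onem.
  by rewrite scalerBl scale1r scalerBr addrCA addrA.
have : `|x - p| ^+ 2 <= `|x - (p + t *: (c - p))| ^+ 2.
  by rewrite ler_sqr ?nnegrE// pE dist_le.
rewrite opprD addrA [X in _ <= X](sqr_normB eucl) dotZr normrZ exprMn.
rewrite (ger0_norm (ltW t0)) -/v -/w.
nra.
Qed.

(** For a polygonal line [p, q, r, s] obtained by alternating projections
    between two convex sets, with [p] and [r] in one and [q] and [s] in the
    other, the hypotheses are the obtuse angle properties at [r] and at [q].
    Together they bound [`|q - r| ^+ 2] by the inner product of [s - r] and
    [q - p]. *)
Lemma zigzag p q r s :
  dot (q - r) (p - r) <= 0 -> dot (p - q) (s - q) <= 0 ->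
  `|q - r| ^+ 2 <= `|p - q| * `|r - s|.
Proof.
move=> h1 h2; rewrite [`|r - s|]distrC [`|p - q|]distrC mulrC.
apply: le_trans (cauchy_schwarz eucl _ _).
rewrite (normr_sqr eucl); move: h1 h2; rewrite !(dotBl, dotBr).
rewrite (dotC dot r q) (dotC dot q p) (dotC dot s q).
by rewrite (dotC dot r p) (dotC dot p s); lra.
Qed.

(** The obtuse angle property read as the law of cosines in the triangle
    [x], [proj C x], [c]. *)
Lemma proj_fejer x C c : closed C -> convex_set C -> C c ->
  `|Defs.proj C x - c| ^+ 2 + `|x - Defs.proj C x| ^+ 2 <= `|x - c| ^+ 2.
Proof.
move=> clC cvC Cc; have := proj_obtuse x clC cvC Cc.
set p := Defs.proj C x; rewrite !(normr_sqr eucl) !(dotBl, dotBr).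
by rewrite (dotC dot c p) (dotC dot p x) (dotC dot c x); lra.
Qed.

End projection.

(** * Log-convex sequences with geometric decay *)

Section log_convex.
Variable R : realType.
Implicit Types (d : nat -> R) (c g : R).

(** Log-convexity makes the ratios of consecutive terms nondecreasing: if one of
    them exceeded [c], so would all later ones by the same margin, and the
    sequence would outgrow every multiple of [c ^+ k]. *)
Lemma log_convex_ratio_le d c g :
  (forall k, 0 <= d k) -> (forall k, d k.+1 ^+ 2 <= d k * d k.+2) ->
  0 <= c -> (forall k, d k <= g * c ^+ k) ->
  forall k, d k.+1 <= c * d k.
Proof.
move=> d0 dd c0 dg k; rewrite leNgt; apply/negP => cd.
have dk : 0 < d k.
  rewrite lt_neqAle d0 andbT; apply/eqP => dk0.
  move: (dd k) cd; rewrite -dk0 mul0r mulr0 => h1 h2.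
  by have := exprn_gt0 2 h2; rewrite ltNge h1.
pose r := d k.+1 / d k.
have rE : r * d k = d k.+1 by rewrite /r divfK// gt_eqF.
have cr : c < r by rewrite ltr_pdivlMr.
have r0 : 0 < r := le_lt_trans c0 cr.
have step n : 0 < d (n + k)%N /\ r * d (n + k)%N <= d (n + k).+1.
  elim: n => [|n [dn IH]]; first by rewrite add0n dk rE.
  have dn1 : 0 < d (n + k).+1 by apply: lt_le_trans IH; rewrite mulr_gt0.
  rewrite addSn; split => //; rewrite -(ler_pM2l dn).
  by apply: le_trans (dd _); nra.
have low n : r ^+ n * d k <= d (n + k)%N.
  elim: n => [|n IH]; first by rewrite expr0 mul1r add0n.
  rewrite addSn; apply: le_trans (step n).2.
  by rewrite exprS -mulrA ler_wpM2l// ltW.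
pose z := c / r.
have z1 : `|z| < 1.
  by rewrite ger0_norm ?divr_ge0// ?(ltW r0)// ltr_pdivrMr// mul1r.
have zb n : d k <= geometric (g * c ^+ k) z n.
  rewrite /= /z exprMn exprVn mulrA ler_pdivlMr ?exprn_gt0// mulrC.
  by apply: le_trans (low n) (le_trans (dg _) _); rewrite addnC exprD mulrA.
suff : d k <= 0 by rewrite leNgt dk.
have cz := cvg_geometric (g * c ^+ k) z1.
by apply: (cvgr_to_ge cz); near=> n; exact: zb.
Unshelve. all: by end_near. Qed.

End log_convex.

(** The steps from [k] on sum to at most [2 * d k] times a geometric series of
    ratio [c]. *)
Lemma R_linear_cvg_tail_le (R : realType) (E : normedModType R)
    (u : nat -> E) (l : E) (d : nat -> R) (c : R) :
  0 <= c < 1 -> R_linear_cvg u l c ->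
  (forall k, `|u k - u k.+1| <= 2 * d k) ->
  (forall k, d k.+1 <= c * d k) ->
  (forall k, 0 <= d k) ->
  forall k, `|u k - l| <= 2 / (1 - c) * d k.
Proof.
move=> /andP[c0 c1] [g g0 ul] ud dc d0 k.
set K := 2 / (1 - c).
have KE : K * (1 - c) = 2 by rewrite /K divfK// subr_eq0 gt_eqF.
have K0 : 0 <= K by rewrite /K divr_ge0// subr_ge0 ltW.
(* [K] solves [K = 2 + K * c], so [K * d] pays for one step and for [K] times
   the next gap. *)
have step m : `|u k - u (m + k)%N| + K * d (m + k)%N <= K * d k.
  elim: m => [|m IH]; first by rewrite add0n subrr normr0 add0r.
  apply: le_trans IH; rewrite addSn.
  have : `|u k - u (m + k).+1| <=
      `|u k - u (m + k)%N| + `|u (m + k)%N - u (m + k).+1|.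
    by apply: le_trans (ler_normD _ _); rewrite subrKA.
  have := ud (m + k)%N; have := ler_wpM2l K0 (dc (m + k)%N).
  have : K * (c * d (m + k)%N) + 2 * d (m + k)%N = K * d (m + k)%N.
    by rewrite -KE; ring.
  lra.
rewrite -subr_le0.
have cz : `|c| < 1 by rewrite ger0_norm.
apply: (cvgr_to_ge (cvg_geometric (g * c ^+ k) cz)); near=> m.
rewrite /= -[g * _ * _]mulrA -exprD addnC lerBlDr.
apply: le_trans (_ : `|u k - u (m + k)%N| + `|u (m + k)%N - l| <= _).
  by apply: le_trans (ler_normD _ _); rewrite subrKA.
rewrite addrC lerD ?ul//; apply: le_trans (step m).
by rewrite lerDl mulr_ge0.
Unshelve. all: by end_near. Qed.

(** * Alternating projections *)

Section alternating.
Variables (R : realType) (E : normedModType R) (dot : {dot E for (@idfun R)}).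
Hypothesis eucl : euclidean dot.
Variables (A B : set E).
Hypotheses (closedA : closed A) (convexA : convex_set A).
Hypotheses (closedB : closed B) (convexB : convex_set B).
Hypothesis AB0 : A `&` B !=set0.
Variable x : nat -> E.
Hypothesis altx : alternating_projections A B x.

Let b k := Defs.proj B (x k).
Let d k := `|x k - b k|.

Let A0 : A !=set0. Proof. by have [s []] := AB0; exists s. Qed.
Let B0 : B !=set0. Proof. by have [s []] := AB0; exists s. Qed.

Let xS k : x k.+1 = Defs.proj A (b k). Proof. exact: altx.2. Qed.

Let xA k : A (x k).
Proof.
case: k => [|k]; first exact: altx.1.
by rewrite xS; exact: (projP eucl _ closedA A0).1.
Qed.

Let bB k : B (b k). Proof. exact: (projP eucl _ closedB B0).1. Qed.

Lemma step_half_le k : `|b k - x k.+1| <= d k.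
Proof.
by rewrite xS (projP eucl _ closedA A0).2 /d distrC dist_le.
Qed.

(** Log-convexity holds for the whole sequence of segment lengths, gaps [d]
    interleaved with return steps [e]; eliminating the [e] leaves it for the
    gaps alone. *)
Lemma gap_log_convex k : d k.+1 ^+ 2 <= d k * d k.+2.
Proof.
pose e k := `|b k - x k.+1|.
have e2 j : e j ^+ 2 <= d j * d j.+1.
  apply: (zigzag eucl); first by rewrite xS (proj_obtuse eucl).
  exact: (proj_obtuse eucl).
have d2 : d k.+1 ^+ 2 <= e k * e k.+1.
  apply: (zigzag eucl); first exact: (proj_obtuse eucl).
  by rewrite [x k.+1]xS (proj_obtuse eucl).
have [d10|d10] := eqVneq (d k.+1) 0.
  by rewrite d10 expr2 mul0r mulr_ge0 ?normr_ge0.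
have d1 : 0 < d k.+1 ^+ 2 by rewrite exprn_gt0// lt_neqAle eq_sym d10 normr_ge0.
rewrite -(ler_pM2r d1).
apply: le_trans (_ : (e k * e k.+1) ^+ 2 <= _).
  by rewrite -expr2 ler_sqr ?nnegrE ?mulr_ge0 ?sqr_ge0 ?normr_ge0.
rewrite exprMn.
apply: le_trans (ler_pM (sqr_ge0 _) (sqr_ge0 _) (e2 k) (e2 k.+1)) _.
by rewrite expr2 mulrACA [d k.+1 * d k.+2]mulrC mulrA mulrACA mulrA.
Qed.

Lemma alternating_fejer s k : (A `&` B) s ->
  `|x k.+1 - s| ^+ 2 + d k ^+ 2 <= `|x k - s| ^+ 2.
Proof.
move=> [As Bs]; have := proj_fejer eucl (x k) closedB convexB Bs.
have := proj_fejer eucl (b k) closedA convexA As.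
rewrite -xS -/(b k) -/(d k); have := sqr_ge0 `|b k - x k.+1|.
lra.
Qed.

(** Fejer monotonicity holds for all points of the intersection with the same
    decrease [d k ^+ 2], so it passes to the infimum. *)
Lemma alternating_dist_fejer k :
  dist (x k.+1) (A `&` B) ^+ 2 + d k ^+ 2 <= dist (x k) (A `&` B) ^+ 2.
Proof.
set D := dist (x k.+1) _.
have D0 : 0 <= D by exact: dist_ge0.
have DD : 0 <= D ^+ 2 + d k ^+ 2 by rewrite addr_ge0 ?sqr_ge0.
rewrite -[leLHS]sqr_sqrtr// ler_sqr ?nnegrE ?sqrtr_ge0 ?dist_ge0//.
apply: le_dist => // s Ss.
rewrite -[leRHS]ger0_norm// -sqrtr_sqr ler_wsqrtr//.
apply: le_trans (alternating_fejer k Ss); rewrite lerD2r.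
by rewrite ler_sqr ?nnegrE// dist_le.
Qed.

Lemma alternating_monotone s k m : (A `&` B) s ->
  `|x (m + k)%N - s| <= `|x k - s|.
Proof.
move=> Ss; elim: m => [|m]; first by rewrite add0n.
apply: le_trans; rewrite addSn -ler_sqr ?nnegrE//.
by apply: le_trans (alternating_fejer (m + k) Ss); rewrite lerDl sqr_ge0.
Qed.

Lemma alternating_diameter k m n :
  `|x (m + k)%N - x (n + k)%N| <= 2 * dist (x k) (A `&` B).
Proof.
rewrite mulrC -ler_pdivrMr//; apply: le_dist => // s Ss.
rewrite ler_pdivrMr//.
have := alternating_monotone k m Ss; have := alternating_monotone k n Ss.
have : `|x (m + k)%N - x (n + k)%N| <= `|x (m + k)%N - s| + `|x (n + k)%N - s|.
  rewrite [`|x (n + k)%N - s|]distrC.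
  by apply: le_trans (ler_normD _ _); rewrite subrKA.
lra.
Qed.

(** The constant comes from [dist (x k) S <= 2 / (1 - c) * d k]: the decrease
    [d k ^+ 2] of the squared distance is at least the fraction
    [((1 - c) / 2) ^+ 2] of it. *)
Lemma linearly_monotone_of_R_linear_cvg xt c : (A `&` B) xt -> 0 <= c < 1 ->
  R_linear_cvg x xt c ->
  linearly_monotone x (A `&` B) (Num.sqrt (1 - ((1 - c) / 2) ^+ 2)).
Proof.
move=> Sxt c01 lin k; have [g g0 xg] := lin.
have /andP[c0 c1] := c01.
have d_le j : d j <= `|x j - xt|.
  by rewrite /d (projP eucl _ closedB B0).2 dist_le//; case: Sxt.
have dc : forall j, d j.+1 <= c * d j.
  apply: (@log_convex_ratio_le _ _ c g) => // [j|j|j].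
  - exact: normr_ge0.
  - exact: gap_log_convex.
  - exact: le_trans (d_le j) (xg j).
have xd j : `|x j - x j.+1| <= 2 * d j.
  have := step_half_le j.
  have : `|x j - x j.+1| <= d j + `|b j - x j.+1|.
    by apply: le_trans (ler_normD _ _); rewrite subrKA.
  lra.
have := R_linear_cvg_tail_le c01 lin xd dc (fun=> normr_ge0 _) k => xtd.
set S := A `&` B in Sxt *.
have Dd : (1 - c) / 2 * dist (x k) S <= d k.
  have c1' : 0 < 1 - c by rewrite subr_gt0.
  rewrite -ler_pdivlMl ?divr_gt0// invf_div.
  by apply: le_trans xtd; exact: dist_le.
have D0 j : 0 <= dist (x j) S by exact: dist_ge0.
have a0 : 0 <= (1 - c) / 2 by lra.
have a1 : 0 <= 1 - ((1 - c) / 2) ^+ 2 by nra.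
rewrite -ler_sqr ?nnegrE ?mulr_ge0 ?sqrtr_ge0// exprMn sqr_sqrtr//.
have := alternating_dist_fejer k; rewrite -/S.
have : ((1 - c) / 2 * dist (x k) S) ^+ 2 <= d k ^+ 2.
  by rewrite ler_sqr ?nnegrE ?normr_ge0// (mulr_ge0 a0 (D0 k)).
rewrite exprMn; lra.
Qed.

(** The diameter of the tail after [k] bounds the distance from [x k] to a
    cluster point, which is therefore the limit. It lies in [A] because every
    term does; for [B] it is approached by points of the intersection nearly
    closest to late terms. *)
Lemma R_linear_cvg_of_linearly_monotone c : 0 <= c < 1 ->
  linearly_monotone x (A `&` B) c ->
  exists2 xt, (A `&` B) xt & R_linear_cvg x xt c.
Proof.
move=> /andP[c0 c1] mon; set S := A `&` B in mon *.
pose D := dist (x 0%N) S.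
have D0 : 0 <= D by exact: dist_ge0.
have Dk k : dist (x k) S <= D * c ^+ k.
  elim: k => [|k IH]; first by rewrite expr0 mulr1.
  by apply: le_trans (mon k) _; rewrite exprS mulrCA ler_wpM2l.
have [n||xt Axt xtP] :=
  @bounded_cluster _ _ _ eucl A x (`|x 0%N| + 2 * D) closedA.
- exact: xA.
- move=> n; have := alternating_diameter 0 n 0; rewrite !addn0 -/S -/D.
  have : `|x n| <= `|x n - x 0%N| + `|x 0%N|.
    by apply: le_trans (ler_normD _ _); rewrite subrK.
  lra.
have xxt k : `|x k - xt| <= 2 * dist (x k) S.
  apply/ler_addgt0Pr => e e0; have [n kn ne] := xtP _ k e0.
  have := alternating_diameter k 0 (n - k); rewrite add0n subnK// -/S.
  have : `|x k - xt| <= `|x k - x n| + `|x n - xt|.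
    by apply: le_trans (ler_normD _ _); rewrite subrKA.
  lra.
have lin k : `|x k - xt| <= (2 * D + 1) * c ^+ k.
  apply: le_trans (xxt k) _; rewrite [(2 * D + 1) * _]mulrDl mul1r.
  rewrite -[2 * D * _]mulrA.
  by rewrite (@le_trans _ _ (2 * (D * c ^+ k)))// ?ler_wpM2l// lerDl exprn_ge0.
exists xt; last by exists (2 * D + 1) => //; rewrite ltr_wpDl// mulr_ge0.
split=> //; apply: closedB => U /nbhs_ballP[e /= e0 eU].
have c'1 : `|c| < 1 by rewrite ger0_norm.
have e40 : 0 < e / 4 by rewrite divr_gt0.
have [N _ /(_ N (leqnn N)) /= DN] :
    \forall n \near \oo, geometric D c n < e / 4.
  exact: cvgr_lt (cvg_geometric D c'1) _ e40.
have [s [As Bs] xs] := dist_adherent (x N) AB0 e40.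
exists s; split => //; apply: eU; rewrite -ball_normE /=.
have : `|xt - s| <= `|x N - xt| + `|x N - s|.
  rewrite [`|x N - xt|]distrC.
  by apply: le_trans (ler_normD _ _); rewrite subrKA.
have := xxt N; have := Dk N; move: xs DN; rewrite -/S /=.
lra.
Qed.

End alternating.

Theorem proposition5p9 (R : realType) (E : normedModType R)
    (dot : {dot E for (@idfun R)}) (euclideanE : euclidean dot)
    (A B : set E)
    (closedA : closed A) (convexA : convex_set A)
    (closedB : closed B) (convexB : convex_set B)
    (AB0 : A `&` B !=set0)
    (x : nat -> E) (altx : alternating_projections A B x) :
  (exists xt : E, (A `&` B) xt /\
     exists c : R, 0 <= c < 1 /\ R_linear_cvg x xt c)
  <->
  (exists c : R, 0 <= c < 1 /\ linearly_monotone x (A `&` B) c).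
Proof.
split=> [[xt [Sxt [c [c01 lin]]]]|[c [c01 mon]]].
  exists (Num.sqrt (1 - ((1 - c) / 2) ^+ 2)); split; last first.
    exact: (linearly_monotone_of_R_linear_cvg euclideanE closedA convexA
      closedB convexB AB0 altx Sxt c01 lin).
  have /andP[_ c1] := c01.
  rewrite sqrtr_ge0 -[ltRHS]sqrtr1 ltr_sqrt// gtrBl exprn_gt0// divr_gt0//.
  by rewrite subr_gt0.
have [xt Sxt lin] := R_linear_cvg_of_linearly_monotone euclideanE
  closedA convexA closedB convexB AB0 altx c01 mon.
by exists xt; split => //; exists c.
Qed.
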